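(* Let $\tau_L,\tau_R,\delta_R\in\mathbb{R}$ with $\delta_R>1$ and $\delta_R>\frac{\tau_R^2}{4}$. Then the following algorithm terminates after finitely many steps; it generates precisely all the non-empty sets $I_n$ (i.e. each set assigned to some $I_n$ by the algorithm is the true $I_n$, and every $I_n$ not assigned is empty), and the value of $\frac mp$ at termination is the rotation number of $f$. Step 1. Let $I_1=(-\infty,0]$ and $(m^-,p^-,z^-)=(0,1,0)$. Let $I_{n^*}=[z_{n^*},1]$, where $z_{n^*}\in(0,1]$ is well-defined (that is, $\alpha_{n^*-1}\neq 0$), and let $(m^+,p^+,z^+)=(1,n^*,z_{n^*})$. Step 2. Let $m=m^-+m^+$ and $p=p^-+p^+$, so $\frac mp=\frac{m^-+m^+}{p^-+p^+}$. Evaluate $\alpha_{p-1}$, and if $\alpha_{p-1}\ne 0$ evaluate $\beta_{p-1}$ and $z_p$. Step 3. If $\alpha_{p-1}=0$ or $z_p\notin(z^-,z^+)$, let $I_p=(z^-,z^+)$ and stop. Otherwise, if $\alpha_{p-1}<0$, let $I_p=[z_p,z^+)$, update $(m^+,p^+,z^+)=(m,p,z_p)$, and return to Step 2; while if $\alpha_{p-1}>0$, let $I_p=(z^-,z_p]$, update $(m^-,p^-,z^-)=(m,p,z_p)$, and return to Step 2.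
   Context: For real parameters $\tau_L,\tau_R,\delta_R$ define $f:\mathbb{R}^2\to\mathbb{R}^2$ by $f(x,y)=(\tau_L x+y+1,\,0)$ if $x\le 0$ and $f(x,y)=(\tau_R x+y+1,\,-\delta_R x)$ if $x\ge 0$; write $f_R(x,y)=(\tau_R x+y+1,\,-\delta_R x)$ for the right piece on all of $\mathbb{R}^2$. Subscripts $1,2$ denote components of a point. For $x\in\mathbb{R}$ the return time $N(x)$ is the smallest $n\ge 1$ with $f^n(x,0)_2=0$, if such $n$ exists. For $n\ge 1$ let $I_n=\{x\in(-\infty,1]: N(x)=n\}$. Let $n^*=N(1)$ (well-defined under the stated hypotheses). With $\phi=\cos^{-1}\!\left(\frac{\tau_R}{2\sqrt{\delta_R}}\right)\in(0,\pi)$, for $r\ge 0$ let $$\alpha_r=\frac{\delta_R^{r/2}\sin((r+1)\phi)}{\sin\phi},\qquad \beta_r=\frac{\sin\phi-\delta_R^{r/2}\sin((r+1)\phi)+\delta_R^{(r+1)/2}\sin(r\phi)}{(\delta_R-\tau_R+1)\sin\phi}.$$ These satisfy $f_R^r(x,0)_1=\alpha_r x+\beta_r$. For $n\ge1$ with $\alpha_{n-1}\neq0$ let $z_n=-\frac{\beta_{n-1}}{\alpha_{n-1}}$. Rotation number. A fraction $\frac{m}{p}$ is irreducible if $m,p$ are integers with no common factors and $p\ge1$. For irreducible $\frac mp\in(0,1)$, its left and right parents are the unique irreducible fractions $\frac{m^-}{p^-}<\frac{m^+}{p^+}$ in $[0,1]$ with $m^+p^--m^-p^+=1$, $m^-+m^+=m$,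 $p^-+p^+=p$. For irreducible $\frac mp\in(0,\frac1{n^*})$, let $\frac{m_1^-}{p_1^-}$ be the left parent of $\frac mp$, $\frac{m_2^-}{p_2^-}$ the left parent of that, and so on until $\frac{m_s^-}{p_s^-}=\frac01$; let $\frac{m_1^+}{p_1^+}$ be the right parent of $\frac mp$, $\frac{m_2^+}{p_2^+}$ the right parent of that, and so on until $\frac{m_t^+}{p_t^+}=\frac1{n^*}$; then $D[m,p;n^*]=(p_s^-,\ldots,p_1^-,p,p_1^+,\ldots,p_t^+)$. The rotation number of $f$ is the unique irreducible fraction $\frac mp\in\left[\frac1{n^*+1},\frac1{n^*}\right)$ such that for all $n\ge1$, $I_n\neq\varnothing$ if and only if $n\in D[m,p;n^*]$, with the non-empty $I_n$ covering $(-\infty,1]$ and ordered from left to right by $D[m,p;n^*]$ (existence and uniqueness hold under the stated hypotheses). *)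

(* Defs.v *)
From Stdlib Require Export Reals List.
Export ListNotations.
Open Scope R_scope.

Definition f_right (tauR deltaR : R) (P : R * R) : R * R :=
  (tauR * fst P + snd P + 1, - deltaR * fst P).

(* The two branches agree on the line x = 0. *)
Definition f (tauL tauR deltaR : R) (P : R * R) : R * R :=
  if Rle_dec (fst P) 0 then (tauL * fst P + snd P + 1, 0)
  else f_right tauR deltaR P.

(* N(x) may fail to exist, so "N(x) = n" is a (functional) relation. *)
Definition is_return_time (tauL tauR deltaR x : R) (n : nat) : Prop :=
  (1 <= n)%nat /\
  snd (Nat.iter n (f tauL tauR deltaR) (x, 0)) = 0 /\
  forall k : nat, (1 <= k < n)%nat ->
    snd (Nat.iter k (f tauL tauR deltaR) (x, 0)) <> 0.

Definition Iset (tauL tauR deltaR : R) (n : nat) (x : R) : Prop :=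
  x <= 1 /\ is_return_time tauL tauR deltaR x n.

Definition phi (tauR deltaR : R) : R := acos (tauR / (2 * sqrt deltaR)).

Definition alpha (tauR deltaR : R) (r : nat) : R :=
  let ph := phi tauR deltaR in
  Rpower deltaR (INR r / 2) * sin (INR (r + 1) * ph) / sin ph.

Definition beta (tauR deltaR : R) (r : nat) : R :=
  let ph := phi tauR deltaR in
  (sin ph - Rpower deltaR (INR r / 2) * sin (INR (r + 1) * ph)
          + Rpower deltaR (INR (r + 1) / 2) * sin (INR r * ph))
  / ((deltaR - tauR + 1) * sin ph).

(* Meaningful for n >= 1 with alpha_{n-1} <> 0 only. *)
Definition z (tauR deltaR : R) (n : nat) : R :=
  - (beta tauR deltaR (n - 1) / alpha tauR deltaR (n - 1)).

(* The pair (m, p) stands for m/p; all fractions involved lie in [0,1], so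
   natural numerators suffice. *)
Definition frac : Type := nat * nat.

Definition frac_val (q : frac) : R := INR (fst q) / INR (snd q).

Definition irreducible (q : frac) : Prop :=
  (1 <= snd q)%nat /\ Nat.gcd (fst q) (snd q) = 1%nat.

Definition are_parents (q ql qr : frac) : Prop :=
  irreducible ql /\ irreducible qr /\
  0 <= frac_val ql /\ frac_val ql < frac_val qr /\ frac_val qr <= 1 /\
  (fst qr * snd ql = fst ql * snd qr + 1)%nat /\
  (fst ql + fst qr = fst q)%nat /\
  (snd ql + snd qr = snd q)%nat.

Definition left_parent (q ql : frac) : Prop := exists qr, are_parents q ql qr.
Definition right_parent (q qr : frac) : Prop := exists ql, are_parents q ql qr.

(* [ancestors parent stop q l]: following [parent] from [q] until [stop] is
   first reached, the denominators met (that of [q] excluded, that of [stop]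
   included) are [l], nearest ancestor first. *)
Inductive ancestors (parent : frac -> frac -> Prop) (stop : frac) :
    frac -> list nat -> Prop :=
| ancestors_stop (q : frac) :
    parent q stop -> ancestors parent stop q [snd stop]
| ancestors_next (q q' : frac) (l : list nat) :
    parent q q' -> q' <> stop -> ancestors parent stop q' l ->
    ancestors parent stop q (snd q' :: l).

(* D is the sequence D[m,p;n*], for q = (m, p). *)
Definition is_D (q : frac) (nstar : nat) (D : list nat) : Prop :=
  exists ls rs : list nat,
    ancestors left_parent (0%nat, 1%nat) q ls /\
    ancestors right_parent (1%nat, nstar) q rs /\
    D = rev ls ++ snd q :: rs.

Definition rotation_property (tauL tauR deltaR : R) (q : frac) : Prop :=
  exists (nstar : nat) (D : list nat),
    is_return_time tauL tauR deltaR 1 nstar /\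
    irreducible q /\
    1 / INR (nstar + 1) <= frac_val q /\ frac_val q < 1 / INR nstar /\
    is_D q nstar D /\
    (forall n : nat, (1 <= n)%nat ->
       ((exists x, Iset tauL tauR deltaR n x) <-> In n D)) /\
    (forall x : R, x <= 1 -> exists n : nat, Iset tauL tauR deltaR n x) /\
    ForallOrdPairs
      (fun a b => forall x y : R,
         Iset tauL tauR deltaR a x -> Iset tauL tauR deltaR b y -> x < y) D.

Definition is_rotation_number (tauL tauR deltaR : R) (q : frac) : Prop :=
  unique (rotation_property tauL tauR deltaR) q.

Record endpoint : Type := Endpoint { ep_m : nat; ep_p : nat; ep_z : R }.

(* The pairs (n, S) recording that the set S has been assigned to I_n. *)
Definition assignments : Type := list (nat * (R -> Prop)).

(* [Running lo hi A]: at the head of the loop, with lo = (m^-, p^-, z^-) and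
   hi = (m^+, p^+, z^+).  [Stopped q A]: halted with final fraction q. *)
Inductive config : Type :=
| Running (lo hi : endpoint) (A : assignments)
| Stopped (q : frac) (A : assignments).

Definition between_dec (a b x : R) : {a < x < b} + {~ a < x < b}.
Proof.
  destruct (Rlt_dec a x); [ destruct (Rlt_dec x b) | ];
    [ left | right | right ]; tauto.
Defined.

Definition init (tauR deltaR : R) (nstar : nat) : config :=
  Running (Endpoint 0 1 0) (Endpoint 1 nstar (z tauR deltaR nstar))
    [ (1%nat, fun x => x <= 0);
      (nstar, fun x => z tauR deltaR nstar <= x <= 1) ].

Definition step (tauR deltaR : R) (c : config) : config :=
  match c with
  | Stopped q A => Stopped q A
  | Running lo hi A =>
      let m := (ep_m lo + ep_m hi)%nat in
      let p := (ep_p lo + ep_p hi)%nat in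
      let a := alpha tauR deltaR (p - 1) in
      let zp := z tauR deltaR p in
      let stop := Stopped (m, p) ((p, fun x => ep_z lo < x < ep_z hi) :: A) in
      if Req_EM_T a 0 then stop
      else if between_dec (ep_z lo) (ep_z hi) zp then
        if Rlt_dec a 0
        then Running lo (Endpoint m p zp) ((p, fun x => zp <= x < ep_z hi) :: A)
        else Running (Endpoint m p zp) hi ((p, fun x => ep_z lo < x <= zp) :: A)
      else stop
  end.

(* Main.v *)
(* For x <= 1 the return time is the first n >= 1 at which the affine function
   orbit x n = alpha_{n-1} x + beta_{n-1} is nonpositive, so everything happens
   on the zeros z_n of these functions.  In a gap (z^-, z^+) left by the
   algorithm all of orbit x 1, ..., orbit x (p^- + p^+ - 1) are positive.  An
   orbit that vanishes at time p restarts at time p + 1, so the values at time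
   p^- + p^+ at the two ends of the gap are governed by where z^- and z^+ first
   return.  The centred quadratic form is multiplied by delta_R > 1 at each step
   and is convex along the line y = 0, hence z^- and z^+ cannot both return into
   [z^-, z^+], and the next affine function is negative at an end of the gap:
   either it is nonpositive on the whole gap, and the algorithm stops, or its
   zero splits the gap.  In the latter case the signs of alpha and a Wronskian
   identity locate the return of the new endpoint, which keeps the positivity
   invariant.  Since returns stay in [0, 1], where the form is bounded, the
   denominators are bounded and the algorithm terminates. *)

Require Import Defs.
From Stdlib Require Import Arith Lra Lia.

(** * Affine orbits and gaps *)

Section Orbit.

Context (tau delta : R).

(* Index shifted by one: [orbit x (S r)] is the first coordinate of
   f_R^r(x, 0), and the point itself is (orbit x (S r), - delta * orbit x r). *)
Fixpoint orbit (x : R) (n : nat) : R :=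
  match n with
  | O => 0
  | S O => x
  | S (S k as m) => tau * orbit x m - delta * orbit x k + 1
  end.

(* [lucas (S r)] is alpha_r. *)
Fixpoint lucas (n : nat) : R :=
  match n with
  | O => 0
  | S O => 1
  | S (S k as m) => tau * lucas m - delta * lucas k
  end.

Lemma orbit_SS x n : orbit x (S (S n)) = tau * orbit x (S n) - delta * orbit x n + 1.
Proof. reflexivity. Qed.

Lemma lucas_SS n : lucas (S (S n)) = tau * lucas (S n) - delta * lucas n.
Proof. reflexivity. Qed.

Lemma two_step_ind (P : nat -> Prop) :
  P 0%nat -> P 1%nat -> (forall n, P n -> P (S n) -> P (S (S n))) -> forall n, P n.
Proof.
  intros H0 H1 HS n.
  enough (P n /\ P (S n)) by tauto.
  induction n as [|n [IH1 IH2]]; split; auto.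
Qed.

(** The constant term cancels in a difference of two orbits, so at a fixed time the orbit is affine
    in its starting point, with slope [lucas n]. *)
Lemma orbit_sub x y n : orbit y n - orbit x n = lucas n * (y - x).
Proof.
  revert n; apply two_step_ind; [simpl; ring | simpl; ring |].
  intros n H1 H2; rewrite !orbit_SS, lucas_SS.
  transitivity (tau * (orbit y (S n) - orbit x (S n)) - delta * (orbit y n - orbit x n));
    [ring | rewrite H1, H2; ring].
Qed.

Lemma orbit_convex_pos l r x n :
  l < x < r -> 0 <= orbit l n -> 0 <= orbit r n ->
  0 < orbit l n \/ 0 < orbit r n -> 0 < orbit x n.
Proof.
  intros Hx Hl Hr Hlr.
  pose proof (orbit_sub l x n) as E1; pose proof (orbit_sub x r n) as E2.
  assert (E : (r - l) * orbit x n = (r - x) * orbit l n + (x - l) * orbit r n).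
  { replace (orbit r n) with (orbit x n + lucas n * (r - x)) by lra.
    replace (orbit l n) with (orbit x n - lucas n * (x - l)) by lra. ring. }
  assert (0 < (r - l) * orbit x n).
  { rewrite E; destruct Hlr.
    - apply Rplus_lt_le_0_compat; [apply Rmult_lt_0_compat | apply Rmult_le_pos]; lra.
    - apply Rplus_le_lt_0_compat; [apply Rmult_le_pos | apply Rmult_lt_0_compat]; lra. }
  apply Rmult_lt_reg_l with (r - l); lra.
Qed.

Lemma orbit_convex_nonneg l r x n :
  l < x < r -> 0 <= orbit l n -> 0 <= orbit r n -> 0 <= orbit x n.
Proof.
  intros Hx Hl Hr.
  destruct (Rlt_dec 0 (orbit l n)); [left; eapply orbit_convex_pos; eauto |].
  destruct (Rlt_dec 0 (orbit r n)); [left; eapply orbit_convex_pos; eauto |].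
  pose proof (orbit_sub l r n) as E; pose proof (orbit_sub l x n) as E'.
  assert (lucas n = 0) by (apply Rmult_eq_reg_r with (r - l); lra).
  replace (orbit x n) with 0 by nra; lra.
Qed.

Lemma orbit_nonneg_end e m n :
  (forall s, 0 < s <= 1 -> 0 < orbit (e + s * (m - e)) n) -> 0 <= orbit e n.
Proof.
  intros Hpos.
  destruct (Rle_dec 0 (orbit e n)) as [|Hneg]; [assumption | exfalso].
  assert (Hm : 0 < orbit m n) by (replace m with (e + 1 * (m - e)) by ring; apply Hpos; lra).
  pose proof (orbit_sub e m n) as E.
  (* The affine function would vanish at this parameter of the segment from [e] to [m], against
     positivity there; no continuity argument is needed. *)
  set (s := - orbit e n / (orbit m n - orbit e n)).
  assert (Hsm : s * (orbit m n - orbit e n) = - orbit e n) by (unfold s; field; lra).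
  assert (Hs : 0 < s <= 1) by (split; nra).
  apply Hpos in Hs.
  pose proof (orbit_sub e (e + s * (m - e)) n) as E'.
  nra.
Qed.

Lemma orbit_nonneg_left_end l r n :
  l < r -> (forall x, l < x < r -> 0 < orbit x n) -> 0 <= orbit l n.
Proof.
  intros Hlr Hpos; apply (orbit_nonneg_end l ((l + r) / 2)).
  intros s Hs; apply Hpos; nra.
Qed.

Lemma orbit_nonneg_right_end l r n :
  l < r -> (forall x, l < x < r -> 0 < orbit x n) -> 0 <= orbit r n.
Proof.
  intros Hlr Hpos; apply (orbit_nonneg_end r ((l + r) / 2)).
  intros s Hs; apply Hpos; nra.
Qed.

(** The recurrence has order two, and a zero at time [p] recreates the initial pair: [0], then a
    starting value. *)
Lemma orbit_restart x p k :
  orbit x p = 0 -> orbit x (p + k) = orbit (orbit x (S p)) k.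
Proof.
  intros Hp; revert k; apply two_step_ind.
  - rewrite Nat.add_0_r; exact Hp.
  - rewrite Nat.add_1_r; reflexivity.
  - intros k H1 H2; rewrite Nat.add_succ_r in H2.
    rewrite !Nat.add_succ_r. rewrite !orbit_SS, H1, H2; reflexivity.
Qed.

(** The left side is the Casoratian of two solutions of the homogeneous recurrence; each step
    multiplies it by [delta]. *)
Lemma lucas_wronskian (d : nat -> R) p :
  (forall n, d (S (S n)) = tau * d (S n) - delta * d n) ->
  lucas p * d (S p) - lucas (S p) * d p = - delta ^ p * d 0%nat.
Proof.
  intros Hd; induction p as [|p IH]; [simpl; ring |].
  rewrite Hd, lucas_SS; simpl pow.
  transitivity (delta * (lucas p * d (S p) - lucas (S p) * d p)); [ring | rewrite IH; ring].
Qed.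

(* In coordinates v = (delta - tau + 1) * orbit - 1, centred at the fixed point
   of f_R, the orbit is linear; [energy] is the invariant quadratic form
   v_1^2 - tau v_0 v_1 + delta v_0^2 at v_0 = -1. *)
Definition energy (x : R) : R :=
  let v := (delta - tau + 1) * x - 1 in v ^ 2 + tau * v + delta.

Lemma energy_growth x p :
  orbit x p = 0 -> energy (orbit x (S p)) = delta ^ p * energy x.
Proof.
  intros Hp.
  (* Each step scales the form by [delta]; since [v] equals [-1] wherever the orbit vanishes, both
     ends, times [0] and [p], are values of [energy]. *)
  assert (H : forall n, let v k := (delta - tau + 1) * orbit x k - 1 in
    v (S n) ^ 2 - tau * v n * v (S n) + delta * v n ^ 2 = delta ^ n * energy x).
  { induction n as [|n IH]; cbv beta zeta in *.
    - unfold energy; simpl; ring.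
    - change (delta ^ S n) with (delta * delta ^ n); rewrite (Rmult_assoc delta (delta ^ n)), <- IH, orbit_SS; ring. }
  specialize (H p); cbv beta zeta in H; rewrite Hp in H; rewrite <- H; unfold energy; ring.
Qed.

Lemma return_displacement x p :
  orbit x p = 0 ->
  (delta - tau + 1) * (orbit x (S p) - x) = lucas p * energy x.
Proof.
  intros Hp.
  set (v k := (delta - tau + 1) * orbit x k - 1).
  (* The expression solves the homogeneous recurrence and vanishes at [0] and [1], hence always; at
     time [p], [v p = v 0 = -1] turns it into the displacement. *)
  assert (H : forall n, v 0%nat * v (S n) - v 1%nat * v n + lucas n * energy x = 0).
  { apply two_step_ind.
    - unfold v; simpl; ring.
    - unfold v, energy; simpl; ring.
    - intros n H1 H2.
      transitivity
        (tau * (v 0%nat * v (S (S n)) - v 1%nat * v (S n) + lucas (S n) * energy x)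
         - delta * (v 0%nat * v (S n) - v 1%nat * v n + lucas n * energy x));
        [| rewrite H1, H2; ring].
      rewrite lucas_SS; unfold v; rewrite !orbit_SS; simpl orbit; ring. }
  specialize (H p); unfold v in H; rewrite Hp in H; simpl (orbit x 0) in H.
  simpl (orbit x 1) in H; lra.
Qed.

Context (Hdelta : 1 < delta) (Hspiral : tau ^ 2 / 4 < delta).

(** This is the characteristic polynomial [t^2 - tau t + delta] at [t = 1]; its discriminant is
    negative. *)
Lemma trace_lt : 0 < delta - tau + 1.
Proof. nra. Qed.

Lemma energy_lower x : delta - tau ^ 2 / 4 <= energy x.
Proof.
  unfold energy; cbv zeta.
  pose proof (pow2_ge_0 ((delta - tau + 1) * x - 1 + tau / 2)); lra.
Qed.

Lemma energy_convex l r x : l <= x <= r -> energy x <= Rmax (energy l) (energy r).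
Proof.
  intros Hx.
  set (D := delta - tau + 1).
  assert (Hl : energy x - energy l = D * (x - l) * (D * (x + l) - 2 + tau))
    by (unfold energy; fold D; ring).
  assert (Hr : energy r - energy x = D * (r - x) * (D * (x + r) - 2 + tau))
    by (unfold energy; fold D; ring).
  assert (HD : 0 < D) by apply trace_lt.
  (* If the chord from [x] to [r] does not descend, [r] dominates; otherwise the chord from [l] to
     [x], whose slope is no larger, descends and [l] dominates. *)
  destruct (Rle_dec 0 (D * (x + r) - 2 + tau)) as [H|H].
  - eapply Rle_trans; [| apply Rmax_r].
    assert (0 <= D * (r - x) * (D * (x + r) - 2 + tau))
      by (repeat apply Rmult_le_pos; lra). lra.
  - eapply Rle_trans; [| apply Rmax_l].
    assert (0 <= D * (x - l) * - (D * (x + l) - 2 + tau)).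
    { repeat apply Rmult_le_pos; nra. }
    lra.
Qed.

Lemma energy_increases x p :
  (1 <= p)%nat -> orbit x p = 0 -> energy x < energy (orbit x (S p)).
Proof.
  intros Hp H0; rewrite (energy_growth x p H0).
  pose proof (energy_lower x); pose proof (Rlt_pow_R1 delta p Hdelta Hp); nra.
Qed.

Lemma return_right x p : orbit x p = 0 -> 0 < lucas p -> x < orbit x (S p).
Proof.
  intros H0 Ha; pose proof (return_displacement x p H0).
  pose proof (energy_lower x); pose proof trace_lt.
  assert (0 < lucas p * energy x) by (apply Rmult_lt_0_compat; lra).
  assert (0 < orbit x (S p) - x); [| lra].
  apply Rmult_lt_reg_l with (delta - tau + 1); lra.
Qed.

Lemma return_left x p : orbit x p = 0 -> lucas p < 0 -> orbit x (S p) < x.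
Proof.
  intros H0 Ha; pose proof (return_displacement x p H0).
  pose proof (energy_lower x); pose proof trace_lt.
  assert (0 < - lucas p * energy x) by (apply Rmult_lt_0_compat; lra).
  assert (0 < x - orbit x (S p)); [| lra].
  apply Rmult_lt_reg_l with (delta - tau + 1); lra.
Qed.

(** The signs of [lucas] make the function vanishing at [zl] increasing and the one vanishing at
    [zr] decreasing, in accordance with [gap_pos]. *)
Record is_gap (pl pr : nat) (zl zr : R) : Prop := {
  gap_pl : (1 <= pl)%nat;
  gap_pr : (1 <= pr)%nat;
  gap_lt : zl < zr;
  gap_lucas_l : 0 < lucas pl;
  gap_lucas_r : lucas pr < 0;
  gap_zero_l : orbit zl pl = 0;
  gap_zero_r : orbit zr pr = 0;
  gap_pos : forall x k, zl < x < zr -> (1 <= k < pl + pr)%nat -> 0 < orbit x k }.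

(** * Ends, splitting and boundedness of a gap *)

Section Gap.

Context (pl pr : nat) (zl zr : R) (Hgap : is_gap pl pr zl zr).

Lemma gap_nonneg_l k : (k < pl + pr)%nat -> 0 <= orbit zl k.
Proof.
  intros Hk; destruct k; [simpl; lra |].
  apply (orbit_nonneg_left_end zl zr); [apply Hgap |].
  intros x Hx; apply (gap_pos _ _ _ _ Hgap); [assumption | lia].
Qed.

Lemma gap_nonneg_r k : (k < pl + pr)%nat -> 0 <= orbit zr k.
Proof.
  intros Hk; destruct k; [simpl; lra |].
  apply (orbit_nonneg_right_end zl zr); [apply Hgap |].
  intros x Hx; apply (gap_pos _ _ _ _ Hgap); [assumption | lia].
Qed.

Lemma gap_image_l : zl < orbit zl (S pl).
Proof. apply return_right; apply Hgap. Qed.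

Lemma gap_image_r : orbit zr (S pr) < zr.
Proof. apply return_left; apply Hgap. Qed.

(** The orbit of [zl] restarts at time [pl]; after [pr] more steps it is compared with that of [zr],
    which is then zero. *)
Lemma gap_end_l : orbit zl (pl + pr) = lucas pr * (orbit zl (S pl) - zr).
Proof.
  rewrite (orbit_restart zl pl pr) by apply Hgap.
  rewrite <- (orbit_sub zr), (gap_zero_r _ _ _ _ Hgap); ring.
Qed.

Lemma gap_end_r : orbit zr (pl + pr) = lucas pl * (orbit zr (S pr) - zl).
Proof.
  rewrite Nat.add_comm, (orbit_restart zr pr pl) by apply Hgap.
  rewrite <- (orbit_sub zl), (gap_zero_l _ _ _ _ Hgap); ring.
Qed.

(* Otherwise both endpoints would return into [zl, zr], on which the convex
   function [energy] is maximal at an endpoint; but returning increases it. *)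
Lemma gap_end_negative : orbit zl (pl + pr) < 0 \/ orbit zr (pl + pr) < 0.
Proof.
  rewrite gap_end_l, gap_end_r.
  pose proof gap_image_l as Il; pose proof gap_image_r as Ir.
  pose proof (energy_increases zl pl (gap_pl _ _ _ _ Hgap) (gap_zero_l _ _ _ _ Hgap)) as El.
  pose proof (energy_increases zr pr (gap_pr _ _ _ _ Hgap) (gap_zero_r _ _ _ _ Hgap)) as Er.
  pose proof (gap_lucas_l _ _ _ _ Hgap); pose proof (gap_lucas_r _ _ _ _ Hgap).
  destruct (Rlt_dec zr (orbit zl (S pl))) as [Hl|Hl]; [left; nra |].
  destruct (Rlt_dec (orbit zr (S pr)) zl) as [Hr|Hr]; [right; nra |].
  exfalso.
  assert (Cl := energy_convex zl zr (orbit zl (S pl))).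
  assert (Cr := energy_convex zl zr (orbit zr (S pr))).
  revert Cl Cr; unfold Rmax; destruct (Rle_dec (energy zl) (energy zr)); lra.
Qed.

(** Positivity has to be extended to the [pr] further times. At each of them after the first, the
    function is positive at [zr], whose return lies in the old gap, and nonnegative at [x], whose
    return lies between [x] and the return of [zl]; affinity fills the interval. *)
Lemma gap_split_r x :
  zl < x < zr -> orbit x (pl + pr) = 0 -> 0 < lucas (pl + pr) ->
  is_gap (pl + pr) pr x zr.
Proof.
  intros Hx H0 Ha.
  pose proof (gap_lucas_l _ _ _ _ Hgap) as Hal; pose proof (gap_lucas_r _ _ _ _ Hgap) as Har.
  pose proof (gap_pl _ _ _ _ Hgap) as Hpl; pose proof (gap_pr _ _ _ _ Hgap) as Hpr.
  pose proof (orbit_sub x zr (pl + pr)) as Ezr.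
  assert (Hzr : 0 < orbit zr (pl + pr)) by nra.
  rewrite gap_end_r in Hzr.
  (* By [gap_end_r], a positive value at [zr] means that [zr] returns to the right of [zl]. *)
  assert (Iyr : zl < orbit zr (S pr) < zr) by (pose proof gap_image_r; split; nra).
  pose proof (return_right x (pl + pr) H0 Ha) as Iy.
  (* The orbits of [x] (shifted by [pr]) and of [zl] both vanish at time [pl];
     the Wronskian orders their next points, because the first starts positive. *)
  assert (Hle : orbit x (S (pl + pr)) < orbit zl (S pl)).
  { pose proof (lucas_wronskian (fun n => orbit x (pr + n) - orbit zl n) pl) as W.
    cbv beta in W.
    rewrite (Nat.add_comm pr pl), H0, (gap_zero_l _ _ _ _ Hgap), Nat.add_0_r in W.
    replace (pr + S pl)%nat with (S (pl + pr)) in W by lia.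
    simpl (orbit zl 0) in W.
    assert (0 < orbit x pr) by (apply (gap_pos _ _ _ _ Hgap); [assumption | lia]).
    assert (0 < delta ^ pl) by (apply pow_lt; lra).
    assert (0 < delta ^ pl * orbit x pr) by (apply Rmult_lt_0_compat; assumption).
    assert (lucas pl * (orbit x (S (pl + pr)) - orbit zl (S pl)) < 0).
    { rewrite Rminus_0_r in W.
      assert (HW := W ltac:(intro; rewrite !Nat.add_succ_r, !orbit_SS; ring)). lra. }
    nra. }
  split; try (apply Hgap); try assumption; try lia; try lra.
  intros y k Hy Hk.
  destruct (Nat.lt_ge_cases k (pl + pr)) as [Hlt|Hge].
  { apply (gap_pos _ _ _ _ Hgap); [lra | lia]. }
  replace k with (pl + pr + (k - (pl + pr)))%nat by lia.
  set (r := (k - (pl + pr))%nat).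
  assert (Hr : (r < pr)%nat) by (unfold r; lia).
  (* At [r = 0] the function vanishes at [x] itself, and its positive slope settles the case. *)
  destruct (Nat.eq_dec r 0) as [->|Hr0].
  { rewrite Nat.add_0_r; pose proof (orbit_sub x y (pl + pr)); nra. }
  assert (Hright : 0 < orbit zr (pl + pr + r)).
  { replace (pl + pr + r)%nat with (pr + (pl + r))%nat by lia.
    rewrite orbit_restart by apply Hgap.
    apply (gap_pos _ _ _ _ Hgap); [lra | lia]. }
  apply (orbit_convex_pos x zr); [lra | | lra | right; assumption].
  rewrite orbit_restart by assumption.
  apply (orbit_convex_nonneg x (orbit zl (S pl))); [lra | |].
  - left; apply (gap_pos _ _ _ _ Hgap); [lra | lia].
  - rewrite <- orbit_restart by apply Hgap. apply gap_nonneg_l; lia.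
Qed.

(** Mirror image of [gap_split_r]: the return of [x] now lies between the return of [zr] and [x]. *)
Lemma gap_split_l x :
  zl < x < zr -> orbit x (pl + pr) = 0 -> lucas (pl + pr) < 0 ->
  is_gap pl (pl + pr) zl x.
Proof.
  intros Hx H0 Ha.
  pose proof (gap_lucas_l _ _ _ _ Hgap) as Hal; pose proof (gap_lucas_r _ _ _ _ Hgap) as Har.
  pose proof (gap_pl _ _ _ _ Hgap) as Hpl; pose proof (gap_pr _ _ _ _ Hgap) as Hpr.
  pose proof (orbit_sub zl x (pl + pr)) as Ezl.
  assert (Hzl : 0 < orbit zl (pl + pr)) by nra.
  rewrite gap_end_l in Hzl.
  assert (Iyl : zl < orbit zl (S pl) < zr) by (pose proof gap_image_l; split; nra).
  pose proof (return_left x (pl + pr) H0 Ha) as Iy.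
  assert (Hle : orbit zr (S pr) < orbit x (S (pl + pr))).
  { pose proof (lucas_wronskian (fun n => orbit x (pl + n) - orbit zr n) pr) as W.
    cbv beta in W.
    rewrite H0, (gap_zero_r _ _ _ _ Hgap), Nat.add_0_r in W.
    replace (pl + S pr)%nat with (S (pl + pr)) in W by lia.
    simpl (orbit zr 0) in W.
    assert (0 < orbit x pl) by (apply (gap_pos _ _ _ _ Hgap); [assumption | lia]).
    assert (0 < delta ^ pr) by (apply pow_lt; lra).
    assert (0 < delta ^ pr * orbit x pl) by (apply Rmult_lt_0_compat; assumption).
    assert (lucas pr * (orbit x (S (pl + pr)) - orbit zr (S pr)) < 0).
    { rewrite Rminus_0_r in W.
      assert (HW := W ltac:(intro; rewrite !Nat.add_succ_r, !orbit_SS; ring)). lra. }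
    nra. }
  split; try (apply Hgap); try assumption; try lia; try lra.
  intros y k Hy Hk.
  destruct (Nat.lt_ge_cases k (pl + pr)) as [Hlt|Hge].
  { apply (gap_pos _ _ _ _ Hgap); [lra | lia]. }
  replace k with (pl + pr + (k - (pl + pr)))%nat by lia.
  set (r := (k - (pl + pr))%nat).
  assert (Hr : (r < pl)%nat) by (unfold r; lia).
  destruct (Nat.eq_dec r 0) as [->|Hr0].
  { rewrite Nat.add_0_r; pose proof (orbit_sub x y (pl + pr)); nra. }
  assert (Hleft : 0 < orbit zl (pl + pr + r)).
  { rewrite <- Nat.add_assoc, orbit_restart by apply Hgap.
    apply (gap_pos _ _ _ _ Hgap); [lra | lia]. }
  apply (orbit_convex_pos zl x); [lra | lra | | left; assumption].
  rewrite orbit_restart by assumption.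
  apply (orbit_convex_nonneg (orbit zr (S pr)) x); [lra | |].
  - rewrite <- orbit_restart by apply Hgap. apply gap_nonneg_r; lia.
  - left; apply (gap_pos _ _ _ _ Hgap); [lra | lia].
Qed.

(** As the orbit vanishes at time [pl], the recurrence leaves [1] minus [delta] times the preceding
    value, which is nonnegative. *)
Lemma gap_image_l_le_1 : orbit zl (S pl) <= 1.
Proof.
  pose proof (gap_pl _ _ _ _ Hgap) as Hpl.
  pose proof (gap_nonneg_l (pl - 1) ltac:(lia)) as Hn.
  pose proof (gap_zero_l _ _ _ _ Hgap) as H0.
  destruct pl as [|k]; [lia |].
  rewrite orbit_SS, H0; simpl (S k - 1)%nat in Hn; rewrite Nat.sub_0_r in Hn; nra.
Qed.

(** A return at time [p] into [[0, 1]] multiplies the energy by [delta ^ p], while convexity bounds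
    it there by its values at [0] and [1]; so both [pl] and [pr] are below [K]. *)
Lemma gap_bounded K :
  (2 <= pl)%nat -> 0 <= zl -> zr <= 1 ->
  energy 0 + energy 1 < delta ^ K * (delta - tau ^ 2 / 4) ->
  (pl + pr < 2 * K)%nat.
Proof.
  intros Hpl H0 H1 HK.
  assert (Hret : forall x p, orbit x p = 0 -> 0 <= orbit x (S p) <= 1 -> (p < K)%nat).
  { intros x p Hp Hx.
    destruct (Nat.lt_ge_cases p K) as [|Hge]; [assumption | exfalso].
    pose proof (energy_convex _ _ _ Hx) as C.
    rewrite (energy_growth x p Hp) in C.
    pose proof (energy_lower x); pose proof (energy_lower 0); pose proof (energy_lower 1).
    assert (delta ^ K <= delta ^ p) by (apply Rle_pow; [lra | lia]).
    assert (0 < delta ^ K) by (apply pow_lt; lra).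
    assert (delta ^ K * (delta - tau ^ 2 / 4) <= delta ^ p * energy x)
      by (apply Rmult_le_compat; lra).
    revert C; unfold Rmax; destruct (Rle_dec (energy 0) (energy 1)); lra. }
  assert (pl < K)%nat.
  { apply (Hret zl); [apply Hgap |].
    pose proof gap_image_l; pose proof gap_image_l_le_1; lra. }
  assert (pr < K)%nat; [| lia].
  apply (Hret zr); [apply Hgap |].
  pose proof gap_image_r.
  (* [2 <= pl] puts the index [S pr] below [pl + pr], where nonnegativity at [zr] is available. *)
  split; [apply gap_nonneg_r; lia | lra].
Qed.

End Gap.

End Orbit.

(** * Closed forms and return times *)

Section ClosedForms.

Context (tau delta : R) (Hdelta : 1 < delta) (Hspiral : tau ^ 2 / 4 < delta).

Lemma sqrt_delta_pos : 0 < sqrt delta.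
Proof. apply sqrt_lt_R0; lra. Qed.

Lemma sqr_sqrt_delta : sqrt delta * sqrt delta = delta.
Proof. apply sqrt_sqrt; lra. Qed.

Lemma cos_arg_bounds : -1 < tau / (2 * sqrt delta) < 1.
Proof.
  pose proof sqrt_delta_pos as Hs; pose proof sqr_sqrt_delta as Hss.
  assert (-(2 * sqrt delta) < tau < 2 * sqrt delta) by (split; nra).
  assert (E : tau / (2 * sqrt delta) * (2 * sqrt delta) = tau) by (field; lra).
  split; nra.
Qed.

Lemma phi_bounds : 0 < phi tau delta < PI.
Proof. apply acos_bound_lt, cos_arg_bounds. Qed.

Lemma sin_phi_pos : 0 < sin (phi tau delta).
Proof. apply sin_gt_0; apply phi_bounds. Qed.

Lemma tau_cos_phi : tau = 2 * sqrt delta * cos (phi tau delta).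
Proof.
  pose proof sqrt_delta_pos; pose proof cos_arg_bounds.
  unfold phi; rewrite cos_acos by lra; field; lra.
Qed.

(** The sine formula for [lucas], with denominators cleared so that only natural powers of
    [sqrt delta] occur. *)
Lemma lucas_trig n :
  sqrt delta * lucas tau delta n * sin (phi tau delta)
  = sqrt delta ^ n * sin (INR n * phi tau delta).
Proof.
  revert n; apply two_step_ind.
  - simpl; rewrite Rmult_0_l, sin_0; ring.
  - simpl; rewrite Rmult_1_l; ring.
  - intros n H1 H2; rewrite lucas_SS.
    transitivity (tau * (sqrt delta * lucas tau delta (S n) * sin (phi tau delta))
                  - delta * (sqrt delta * lucas tau delta n * sin (phi tau delta)));
      [ring | rewrite H1, H2].
    transitivity (2 * sqrt delta * cos (phi tau delta)
                    * (sqrt delta ^ S n * sin (INR (S n) * phi tau delta))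
                  - sqrt delta * sqrt delta * (sqrt delta ^ n * sin (INR n * phi tau delta)));
      [rewrite <- tau_cos_phi, sqr_sqrt_delta; reflexivity |].
    replace (INR (S (S n)) * phi tau delta)
      with (INR (S n) * phi tau delta + phi tau delta) by (rewrite (S_INR (S n)); ring).
    replace (INR n * phi tau delta)
      with (INR (S n) * phi tau delta - phi tau delta) by (rewrite S_INR; ring).
    rewrite sin_plus, sin_minus; simpl pow; ring.
Qed.

Lemma Rpower_half n : Rpower delta (INR n / 2) = sqrt delta ^ n.
Proof.
  replace (INR n / 2) with (/ 2 * INR n) by field.
  rewrite <- Rpower_mult, Rpower_sqrt, Rpower_pow; auto using sqrt_delta_pos; lra.
Qed.

Lemma alpha_lucas r : alpha tau delta r = lucas tau delta (S r).
Proof.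
  pose proof sin_phi_pos; pose proof sqrt_delta_pos.
  unfold alpha; cbv zeta; rewrite Rpower_half, Nat.add_1_r.
  apply Rmult_eq_reg_l with (sqrt delta * sin (phi tau delta));
    [| apply Rgt_not_eq, Rmult_lt_0_compat; lra].
  transitivity (sqrt delta * lucas tau delta (S r) * sin (phi tau delta)); [| ring].
  rewrite lucas_trig; simpl pow; field; lra.
Qed.

Lemma orbit_0_lucas r :
  (delta - tau + 1) * orbit tau delta 0 (S r)
  = 1 - lucas tau delta (S r) + delta * lucas tau delta r.
Proof.
  revert r; apply two_step_ind; [simpl; ring | simpl; ring |].
  intros n H1 H2; rewrite orbit_SS.
  transitivity (tau * ((delta - tau + 1) * orbit tau delta 0 (S (S n)))
    - delta * ((delta - tau + 1) * orbit tau delta 0 (S n)) + (delta - tau + 1)); [ring |].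
  rewrite H1, H2, !lucas_SS; ring.
Qed.

Lemma beta_orbit r : beta tau delta r = orbit tau delta 0 (S r).
Proof.
  pose proof sin_phi_pos; pose proof sqrt_delta_pos.
  pose proof (trace_lt tau delta Hdelta Hspiral) as HD.
  apply Rmult_eq_reg_l with (delta - tau + 1); [| lra].
  rewrite orbit_0_lucas, <- alpha_lucas; unfold alpha, beta; cbv zeta.
  rewrite !Rpower_half, !Nat.add_1_r.
  replace (delta * lucas tau delta r)
    with (sqrt delta ^ S r * sin (INR r * phi tau delta) / sin (phi tau delta)).
  - field; lra.
  - apply Rmult_eq_reg_r with (sin (phi tau delta)); [| lra].
    transitivity (sqrt delta * (sqrt delta ^ r * sin (INR r * phi tau delta)));
      [simpl pow; field; lra |].
    rewrite <- lucas_trig.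
    transitivity (sqrt delta * sqrt delta * lucas tau delta r * sin (phi tau delta));
      [ring | rewrite sqr_sqrt_delta; reflexivity].
Qed.

Lemma orbit_z n : (1 <= n)%nat -> lucas tau delta n <> 0 ->
  orbit tau delta (z tau delta n) n = 0.
Proof.
  intros Hn Ha; unfold z; rewrite alpha_lucas, beta_orbit.
  replace (S (n - 1)) with n by lia.
  pose proof (orbit_sub tau delta 0 (- (orbit tau delta 0 n / lucas tau delta n)) n) as E.
  replace (lucas tau delta n * (- (orbit tau delta 0 n / lucas tau delta n) - 0))
    with (- orbit tau delta 0 n) in E by (field; assumption).
  lra.
Qed.

(** The index [k] is the last one with [k * phi <= 2 * PI]. As [phi < PI], the angle is then in the
    lower half-turn at [k] and in the upper one at [S k]. *)
Lemma lucas_sign_change :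
  exists k, (1 <= k)%nat /\ lucas tau delta k <= 0 <= lucas tau delta (S k).
Proof.
  pose proof phi_bounds as Hphi; pose proof sin_phi_pos as Hsin.
  pose proof sqrt_delta_pos as Hs; pose proof PI_RGT_0 as HPI.
  assert (Hfloor : forall n, 2 * PI < INR n * phi tau delta ->
    exists k, INR k * phi tau delta <= 2 * PI < INR (S k) * phi tau delta).
  { induction n as [|n IH]; intros H; [simpl in H; lra |].
    destruct (Rlt_dec (2 * PI) (INR n * phi tau delta)); [auto | exists n; lra]. }
  destruct (INR_archimed (phi tau delta) (2 * PI)) as [n Hn]; [lra |].
  destruct (Hfloor n Hn) as [k [Hk1 Hk2]].
  assert (HS : INR (S k) * phi tau delta = INR k * phi tau delta + phi tau delta)
    by (rewrite S_INR; ring).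
  exists k; split.
  { destruct k; [simpl in *; lra | lia]. }
  assert (Hsign : forall j s, s = sin (INR j * phi tau delta) ->
     sqrt delta * sin (phi tau delta) * lucas tau delta j = sqrt delta ^ j * s).
  { intros j s ->; rewrite <- lucas_trig; ring. }
  assert (Hc : 0 < sqrt delta * sin (phi tau delta)) by (apply Rmult_lt_0_compat; lra).
  split.
  - specialize (Hsign k _ eq_refl).
    assert (sin (INR k * phi tau delta) <= 0) by (apply sin_le_0; lra).
    assert (0 < sqrt delta ^ k) by (apply pow_lt; lra).
    nra.
  - specialize (Hsign (S k) _ eq_refl).
    assert (0 <= sin (INR (S k) * phi tau delta)).
    { replace (INR (S k) * phi tau delta)
        with (INR (S k) * phi tau delta - 2 * PI + 2 * INR 1 * PI) by (simpl; ring).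
      rewrite sin_period; apply sin_ge_0; lra. }
    assert (0 < sqrt delta ^ S k) by (apply pow_lt; lra).
    nra.
Qed.

(** The quadratic form preserved up to the factor [delta], evaluated on the homogeneous solution,
    where it starts at [1]. *)
Lemma lucas_norm n :
  lucas tau delta (S n) ^ 2 - tau * lucas tau delta (S n) * lucas tau delta n
  + delta * lucas tau delta n ^ 2 = delta ^ n.
Proof.
  induction n as [|n IH]; [simpl; ring |].
  change (delta ^ S n) with (delta * delta ^ n); rewrite <- IH, lucas_SS; ring.
Qed.

Lemma orbit_0_succ k : orbit tau delta 0 (S k) = orbit tau delta 1 k.
Proof.
  change (S k) with (1 + k)%nat; rewrite orbit_restart by reflexivity.
  f_equal; simpl; ring.
Qed.

(** This yields the existence of [n*]. At a sign change of [lucas], the norm identity forces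
    [a + delta * b >= 1] for nonnegative [a] and [b], and [orbit_0_lucas] turns this into a
    nonpositive orbit value. *)
Lemma orbit_1_nonpos : exists k, (1 <= k)%nat /\ orbit tau delta 1 k <= 0.
Proof.
  destruct lucas_sign_change as [k [Hk [Ha Hb]]].
  exists k; split; [assumption |].
  rewrite <- orbit_0_succ.
  pose proof (orbit_0_lucas k) as E; pose proof (lucas_norm k) as N.
  pose proof (trace_lt tau delta Hdelta Hspiral) as HD.
  pose proof (pow_R1_Rle delta k) as Hp.
  set (a := lucas tau delta (S k)) in *; set (b := - lucas tau delta k).
  replace (lucas tau delta k) with (- b) in * by (unfold b; ring).
  assert (tau <= 2 * delta) by lra.
  assert (0 <= a * b) by (apply Rmult_le_pos; lra).
  (* The square dominates [a^2 + tau a b + delta b^2 = delta^k] term by term, because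
     [tau <= 2 * delta] and [delta <= delta^2]. *)
  assert (1 <= (a + delta * b) ^ 2).
  { assert (tau * (a * b) <= 2 * delta * (a * b)) by (apply Rmult_le_compat_r; lra).
    assert (delta * b ^ 2 <= delta * delta * b ^ 2)
      by (apply Rmult_le_compat_r; [apply pow2_ge_0 | nra]).
    lra. }
  assert (0 <= delta * b) by (apply Rmult_le_pos; lra).
  assert (1 <= a + delta * b) by nra.
  nra.
Qed.

(** The return time read off the right-hand orbit alone, hence free of [tauL]: the left branch only
    serves to land on [y = 0]. *)
Definition returns (x : R) (n : nat) : Prop :=
  (1 <= n)%nat /\ orbit tau delta x n <= 0 /\
  forall k, (1 <= k < n)%nat -> 0 < orbit tau delta x k.

Lemma returns_exists x k :
  (1 <= k)%nat -> orbit tau delta x k <= 0 -> exists n, returns x n.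
Proof.
  intros Hk Hneg.
  assert (H : forall n, (exists m, returns x m) \/
                        (forall j, (1 <= j <= n)%nat -> 0 < orbit tau delta x j)).
  { induction n as [|n [IH|IH]]; [right; lia | left; assumption |].
    destruct (Rlt_dec 0 (orbit tau delta x (S n))) as [Hp|Hp].
    - right; intros j Hj; destruct (Nat.eq_dec j (S n)) as [->|]; [assumption |].
      apply IH; lia.
    - left; exists (S n); split; [lia | split; [lra |]].
      intros j Hj; apply IH; lia. }
  destruct (H k) as [|Hpos]; [assumption |].
  specialize (Hpos k ltac:(lia)); lra.
Qed.

Lemma returns_unique x n n' : returns x n -> returns x n' -> n = n'.
Proof.
  intros [Hn [H0 Hpos]] [Hn' [H0' Hpos']].
  destruct (Nat.lt_trichotomy n n') as [Hlt|[Heq|Hlt]]; [| assumption |].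
  - specialize (Hpos' n ltac:(lia)); lra.
  - specialize (Hpos n' ltac:(lia)); lra.
Qed.

(** * The initial gap, from [0] to the zero at time [n*] *)

Section FirstGap.

Context (nstar : nat) (Hret : returns 1 nstar).

Lemma nstar_ge_2 : (2 <= nstar)%nat.
Proof.
  destruct Hret as [H1 [H0 _]].
  destruct nstar as [|[|n]]; [lia | simpl in H0; lra | lia].
Qed.

(** At [1] this is minimality of [nstar]; the orbit of [0] is that of [1] delayed by one step, and
    affinity covers the points between. *)
Lemma orbit_pos_before_nstar x k :
  0 < x <= 1 -> (1 <= k < nstar)%nat -> 0 < orbit tau delta x k.
Proof.
  intros Hx Hk; destruct Hret as [_ [_ Hpos]].
  destruct (Req_dec x 1) as [->|]; [auto |].
  apply (orbit_convex_pos tau delta 0 1); [lra | | left; auto | right; auto].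
  destruct k as [|[|k]]; [lia | simpl; lra |].
  rewrite orbit_0_succ; left; apply Hpos; lia.
Qed.

Lemma orbit_0_nstar_pos : 0 < orbit tau delta 0 nstar.
Proof.
  pose proof nstar_ge_2 as H2; destruct Hret as [_ [_ Hpos]].
  replace nstar with (S (nstar - 1)) by lia.
  rewrite orbit_0_succ; apply Hpos; lia.
Qed.

(** At time [nstar] the affine function is positive at [0] and nonpositive at [1]. *)
Lemma lucas_nstar_neg : lucas tau delta nstar < 0.
Proof.
  destruct Hret as [_ [H0 _]].
  pose proof orbit_0_nstar_pos; pose proof (orbit_sub tau delta 0 1 nstar); lra.
Qed.

Lemma z_nstar_bounds : 0 < z tau delta nstar <= 1.
Proof.
  pose proof nstar_ge_2; pose proof lucas_nstar_neg as Ha.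
  pose proof orbit_0_nstar_pos; destruct Hret as [_ [Hneg _]].
  pose proof (orbit_z nstar ltac:(lia) ltac:(lra)) as Hz.
  pose proof (orbit_sub tau delta 0 (z tau delta nstar) nstar).
  pose proof (orbit_sub tau delta (z tau delta nstar) 1 nstar).
  split; nra.
Qed.

Lemma first_gap : is_gap tau delta 1 nstar 0 (z tau delta nstar).
Proof.
  pose proof nstar_ge_2; pose proof lucas_nstar_neg as Ha; pose proof z_nstar_bounds.
  pose proof (orbit_z nstar ltac:(lia) ltac:(lra)) as Hz.
  split; try lia; try lra; try assumption; [simpl; lra | reflexivity |].
  intros x k Hx Hk; destruct (Nat.eq_dec k nstar) as [->|].
  - pose proof (orbit_sub tau delta x (z tau delta nstar) nstar); nra.
  - apply orbit_pos_before_nstar; [lra | lia].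
Qed.

End FirstGap.

Lemma gap_stop pl pr zl zr x :
  is_gap tau delta pl pr zl zr ->
  lucas tau delta (pl + pr) = 0 \/ ~ zl < z tau delta (pl + pr) < zr ->
  zl < x < zr -> orbit tau delta x (pl + pr) <= 0.
Proof.
  intros Hgap Hstop Hx.
  pose proof (gap_end_negative tau delta Hdelta Hspiral _ _ _ _ Hgap) as Hneg.
  pose proof (orbit_sub tau delta zl x (pl + pr)) as El.
  pose proof (orbit_sub tau delta x zr (pl + pr)) as Er.
  destruct (Req_dec (lucas tau delta (pl + pr)) 0) as [Ha|Ha]; [rewrite Ha in *; lra |].
  destruct Hstop as [|Hstop]; [contradiction |].
  pose proof (gap_pl _ _ _ _ _ _ Hgap).
  pose proof (orbit_z (pl + pr) ltac:(lia) Ha) as Hz.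
  set (zp := z tau delta (pl + pr)) in *.
  destruct (Rle_dec (orbit tau delta x (pl + pr)) 0) as [|Hpos]; [assumption | exfalso].
  (* A positive value at [x] and a negative one at an end of the gap force the zero strictly
     inside. *)
  apply Hstop; clear Hstop.
  pose proof (orbit_sub tau delta zl zp (pl + pr)).
  pose proof (orbit_sub tau delta x zp (pl + pr)).
  pose proof (orbit_sub tau delta zp zr (pl + pr)).
  destruct Hneg; split; nra.
Qed.

(** * Return times of [f] and signs of the orbit *)

Section ReturnTime.

Context (tauL : R).

Lemma iter_f_orbit x k :
  (forall j, (1 <= j <= k)%nat -> 0 < orbit tau delta x j) ->
  Nat.iter k (f tauL tau delta) (x, 0)
  = (orbit tau delta x (S k), - delta * orbit tau delta x k).
Proof.
  induction k as [|k IH]; intros Hpos.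
  - simpl; f_equal; ring.
  - rewrite Nat.iter_succ, IH by (intros; apply Hpos; lia).
    specialize (Hpos (S k) ltac:(lia)).
    unfold f, f_right; cbn [fst snd].
    destruct (Rle_dec (orbit tau delta x (S k)) 0); [lra |].
    rewrite orbit_SS; f_equal; ring.
Qed.

Lemma iter_f_lands x k :
  (forall j, (1 <= j <= k)%nat -> 0 < orbit tau delta x j) ->
  orbit tau delta x (S k) <= 0 ->
  snd (Nat.iter (S k) (f tauL tau delta) (x, 0)) = 0.
Proof.
  intros Hpos Hneg; rewrite Nat.iter_succ, iter_f_orbit by assumption.
  unfold f; cbn [fst snd].
  destruct (Rle_dec (orbit tau delta x (S k)) 0); [reflexivity | contradiction].
Qed.

(** While the orbit is positive, the second coordinate is [- delta] times a positive number; at the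
    first nonpositive value the left branch makes it zero. *)
Lemma return_time_returns x n :
  is_return_time tauL tau delta x n <-> returns x n.
Proof.
  split.
  - intros [Hn [H0 Hne]].
    assert (Hpos : forall m, (m < n)%nat ->
      forall k, (1 <= k <= m)%nat -> 0 < orbit tau delta x k).
    { induction m as [|m IH]; intros Hm k Hk; [lia |].
      destruct (Nat.eq_dec k (S m)) as [->|]; [| apply IH; lia].
      destruct (Rlt_dec 0 (orbit tau delta x (S m))) as [|Hneg]; [assumption | exfalso].
      apply (Hne (S m)); [lia |].
      apply iter_f_lands; [intros; apply IH; lia | lra]. }
    split; [assumption | split].
    + destruct (Rle_dec (orbit tau delta x n) 0) as [|Hneg]; [assumption | exfalso].
      rewrite iter_f_orbit in H0; [cbn [snd] in H0; nra |].
      intros j Hj; destruct (Nat.eq_dec j n) as [->|]; [lra |].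
      apply (Hpos (n - 1)%nat); lia.
    + intros k Hk; apply (Hpos (n - 1)%nat); lia.
  - intros [Hn [H0 Hpos]]; split; [assumption | split].
    + replace n with (S (n - 1)) in * by lia.
      apply iter_f_lands; [intros; apply Hpos; lia | assumption].
    + intros k Hk; rewrite iter_f_orbit by (intros; apply Hpos; lia).
      cbn [snd]; specialize (Hpos k Hk); nra.
Qed.

End ReturnTime.

End ClosedForms.

(** * Farey parents and ancestor lists *)

Lemma coprime_of_det m p m' p' :
  (m' * p = m * p' + 1)%nat -> Nat.gcd m p = 1%nat /\ Nat.gcd m' p' = 1%nat.
Proof.
  intros E.
  assert (H : forall g, Nat.divide g (m * p') -> Nat.divide g (m' * p) -> g = 1%nat).
  { intros g H1 H2; rewrite E in H2.
    apply Nat.divide_1_r, (Nat.divide_add_cancel_r g (m * p')); assumption. }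
  split; apply H.
  - apply Nat.divide_mul_l, Nat.gcd_divide_l.
  - apply Nat.divide_mul_r, Nat.gcd_divide_r.
  - apply Nat.divide_mul_r, Nat.gcd_divide_r.
  - apply Nat.divide_mul_l, Nat.gcd_divide_l.
Qed.

Lemma frac_val_lt m p m' p' :
  (1 <= p)%nat -> (1 <= p')%nat -> (m * p' < m' * p)%nat ->
  frac_val (m, p) < frac_val (m', p').
Proof.
  intros Hp Hp' H; unfold frac_val; cbn [fst snd].
  apply lt_INR in H; rewrite !mult_INR in H.
  apply le_INR in Hp; apply le_INR in Hp'; simpl (INR 1) in *.
  apply Rmult_lt_reg_r with (INR p * INR p'); [apply Rmult_lt_0_compat; lra |].
  replace (INR m / INR p * (INR p * INR p')) with (INR m * INR p') by (field; lra).
  replace (INR m' / INR p' * (INR p * INR p')) with (INR m' * INR p) by (field; lra).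
  assumption.
Qed.

Lemma frac_val_le m p m' p' :
  (1 <= p)%nat -> (1 <= p')%nat -> (m * p' <= m' * p)%nat ->
  frac_val (m, p) <= frac_val (m', p').
Proof.
  intros Hp Hp' H; unfold frac_val; cbn [fst snd].
  apply le_INR in H; rewrite !mult_INR in H.
  apply le_INR in Hp; apply le_INR in Hp'; simpl (INR 1) in *.
  apply Rmult_le_reg_r with (INR p * INR p'); [apply Rmult_lt_0_compat; lra |].
  replace (INR m / INR p * (INR p * INR p')) with (INR m * INR p') by (field; lra).
  replace (INR m' / INR p' * (INR p * INR p')) with (INR m' * INR p) by (field; lra).
  assumption.
Qed.

Lemma frac_val_inv n : frac_val (1%nat, n) = 1 / INR n.
Proof. reflexivity. Qed.

Lemma mediant_parents m p m' p' :
  (1 <= p)%nat -> (1 <= p')%nat -> (m' <= p')%nat -> (m' * p = m * p' + 1)%nat ->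
  are_parents (m + m', p + p')%nat (m, p) (m', p').
Proof.
  intros Hp Hp' Hle E; destruct (coprime_of_det _ _ _ _ E).
  repeat split; cbn [fst snd]; try assumption.
  - replace 0 with (frac_val (0%nat, 1%nat)) by (unfold frac_val; simpl; field).
    apply frac_val_le; lia.
  - apply frac_val_lt; lia.
  - replace 1 with (frac_val (1%nat, 1%nat)) by (unfold frac_val; simpl; field).
    apply frac_val_le; lia.
Qed.

Lemma mediant_irreducible m p m' p' :
  (1 <= p)%nat -> (m' * p = m * p' + 1)%nat -> irreducible (m + m', p + p')%nat.
Proof.
  intros Hp E; split; cbn [fst snd]; [lia |].
  apply (coprime_of_det _ _ m' p'); lia.
Qed.

Lemma left_parent_lt q ql : left_parent q ql -> (snd ql < snd q)%nat.
Proof. intros [qr [_ [[H _] H']]]; lia. Qed.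

Lemma right_parent_lt q qr : right_parent q qr -> (snd qr < snd q)%nat.
Proof. intros [ql [[H _] H']]; lia. Qed.

Lemma left_parent_det q ql :
  left_parent q ql -> (fst q * snd ql = fst ql * snd q + 1)%nat.
Proof. intros [qr (_ & _ & _ & _ & _ & E & Em & Ep)]; nia. Qed.

Lemma ancestors_lt (parent : frac -> frac -> Prop) stop q l :
  (forall q q', parent q q' -> (snd q' < snd q)%nat) ->
  ancestors parent stop q l -> forall n, In n l -> (n < snd q)%nat.
Proof.
  intros Hlt H; induction H as [q Hq | q q' l Hq _ _ IH]; intros n Hn.
  - destruct Hn as [<-|[]]; auto.
  - specialize (Hlt _ _ Hq); destruct Hn as [<-|Hn]; [assumption |].
    specialize (IH n Hn); lia.
Qed.

Lemma ancestors_head (parent : frac -> frac -> Prop) stop q l :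
  ancestors parent stop q l -> exists q' l', l = snd q' :: l' /\ parent q q'.
Proof. destruct 1; eauto. Qed.

(** The pivot is the strict maximum of the list, so it is determined with its position. This
    recovers [p] and the left ancestors from [D]. *)
Lemma split_at_max p p' (a a' b b' : list nat) :
  (forall n, In n a \/ In n b -> (n < p)%nat) ->
  (forall n, In n a' \/ In n b' -> (n < p')%nat) ->
  a ++ p :: b = a' ++ p' :: b' -> p = p' /\ a = a'.
Proof.
  intros H H' E.
  assert (Hp : p = p').
  { assert (I : In p (a' ++ p' :: b')) by (rewrite <- E; apply in_elt).
    assert (I' : In p' (a ++ p :: b)) by (rewrite E; apply in_elt).
    apply in_app_or in I; apply in_app_or in I'; simpl in I, I'.
    specialize (H p'); specialize (H' p).
    destruct (Nat.lt_trichotomy p p') as [?|[?|?]]; [| assumption |]; exfalso;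
      intuition lia. }
  subst p'; split; [reflexivity |].
  revert a' H' E; induction a as [|x a IH]; intros [|x' a'] H' E; simpl in E.
  - reflexivity.
  - injection E as -> _; specialize (H' x' ltac:(left; left; reflexivity)); lia.
  - injection E as -> _; specialize (H p ltac:(left; left; reflexivity)); lia.
  - injection E as -> E; f_equal; apply IH; [| | assumption].
    + intros n [Hn|Hn]; apply H; simpl; tauto.
    + intros n [Hn|Hn]; apply H'; simpl; tauto.
Qed.

Lemma ForallOrdPairs_app {T : Type} (Rel : T -> T -> Prop) l1 l2 :
  ForallOrdPairs Rel l1 -> ForallOrdPairs Rel l2 ->
  (forall x y, In x l1 -> In y l2 -> Rel x y) -> ForallOrdPairs Rel (l1 ++ l2).
Proof.
  intros H1 H2; induction H1 as [|x l1 Hx H1 IH]; intros H; simpl; [assumption |].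
  constructor.
  - apply Forall_app; split; [assumption | apply Forall_forall].
    intros y Hy; apply H; simpl; auto.
  - apply IH; intros y y' Hy Hy'; apply H; simpl; auto.
Qed.

(** Asymmetry makes the head the unique least element and also rules out repetitions. *)
Lemma ForallOrdPairs_ext_eq {T : Type} (Rel : T -> T -> Prop) l1 l2 :
  ForallOrdPairs Rel l1 -> ForallOrdPairs Rel l2 ->
  (forall x y, In x l1 -> In y l1 -> Rel x y -> ~ Rel y x) ->
  (forall x, In x l1 <-> In x l2) -> l1 = l2.
Proof.
  intros H1; revert l2; induction H1 as [|x l1 Hx H1 IH]; intros [|y l2] H2 Has Hin.
  - reflexivity.
  - destruct (proj2 (Hin y)); simpl; auto.
  - destruct (proj1 (Hin x)); simpl; auto.
  - inversion H2 as [|? ? Hy H2']; subst.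
    rewrite Forall_forall in Hx, Hy.
    assert (x = y) as <-.
    { destruct (proj1 (Hin x)) as [|Ix]; simpl; auto.
      destruct (proj2 (Hin y)) as [|Iy]; simpl; auto.
      exfalso; apply (Has x y); simpl; auto. }
    f_equal; apply IH; [assumption | |].
    + intros u v Hu Hv; apply Has; simpl; auto.
    + intros u; destruct (Hin u) as [F G]; simpl in F, G; split; intros Hu.
      * destruct F as [<-|]; auto; exfalso; apply (Has x x); simpl; auto.
      * destruct G as [<-|]; auto; exfalso; apply (Has x x); simpl; auto.
        all: specialize (Hy _ Hu); auto.
Qed.

(** Both numerators are inverses of [l] modulo [p] and both lie in [[0, p)]. *)
Lemma numerator_unique m m' p l n n' :
  (m < p)%nat -> (m' < p)%nat ->
  (m * l = n * p + 1)%nat -> (m' * l = n' * p + 1)%nat -> m = m'.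
Proof.
  assert (H : forall m m' n n', (m <= m')%nat -> (m' < p)%nat ->
    (m * l = n * p + 1)%nat -> (m' * l = n' * p + 1)%nat -> m = m').
  { clear; intros m m' n n' Hle Hlt E E'.
    assert (D : Nat.divide p (l * (m' - m))).
    { exists (n' - n)%nat; rewrite Nat.mul_comm, !Nat.mul_sub_distr_r; lia. }
    apply Nat.gauss in D.
    - destruct D as [c Hc]; destruct c; [lia | nia].
    - apply (coprime_of_det p l m n); lia. }
  intros Hm Hm' E E'; destruct (Nat.le_ge_cases m m').
  - eapply H; eassumption.
  - symmetry; eapply H; eassumption.
Qed.

(** * The algorithm *)

Section Algorithm.

Context (tauL tau delta : R) (Hdelta : 1 < delta) (Hspiral : tau ^ 2 / 4 < delta).

Lemma Iset_returns n x :
  Iset tauL tau delta n x <-> x <= 1 /\ returns tau delta x n.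
Proof. unfold Iset; rewrite return_time_returns by assumption; reflexivity. Qed.

(** The non-empty sets and their order determine [D]; its maximum is the denominator, and the entry
    just before it is the denominator of the left parent, which fixes the numerator modulo [p]. *)
Lemma rotation_property_unique q q' :
  rotation_property tauL tau delta q -> rotation_property tauL tau delta q' -> q = q'.
Proof.
  intros [ns [D (Hns & [Hp1 _] & _ & Hq & (ls & rs & Hls & Hrs & HD) & HI & _ & HO)]].
  intros [ns' [D' (Hns' & [Hp1' _] & _ & Hq' & (ls' & rs' & Hls' & Hrs' & HD') & HI' & _ & HO')]].
  rewrite return_time_returns in Hns, Hns' by assumption.
  assert (ns' = ns) as -> by (eapply returns_unique; eassumption).
  pose proof (nstar_ge_2 _ _ _ Hns) as H2.
  assert (Hpos : forall P q l n, ancestors P (0%nat, 1%nat) q l \/ ancestors P (1%nat, ns) q l ->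
    (forall q q', P q q' -> irreducible q') -> In n l -> (1 <= n)%nat).
  { intros P r l n [H|H] HP; induction H as [r Hr | r r' l Hr _ _ IH]; intros [<-|Hn];
      try contradiction; try (apply (HP _ _ Hr)); auto. }
  (* Non-emptiness is tied to membership in [D] only for [n >= 1], so positivity of the entries
     comes first. *)
  assert (HDpos : forall ls rs q n,
    ancestors left_parent (0%nat, 1%nat) q ls -> ancestors right_parent (1%nat, ns) q rs ->
    In n (rev ls ++ snd q :: rs) -> (1 <= n)%nat).
  { intros l r s n Hl Hr Hn.
    apply in_app_or in Hn; destruct Hn as [Hn|[<-|Hn]].
    - apply in_rev in Hn; apply (Hpos left_parent s l); auto.
      intros ? ? [? [? _]]; assumption.
    - destruct (ancestors_head _ _ _ _ Hl) as (s' & _ & _ & Hs).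
      pose proof (left_parent_lt _ _ Hs); lia.
    - apply (Hpos right_parent s r); auto.
      intros ? ? [? [_ [? _]]]; assumption. }
  assert (Hmax : forall ls rs q,
    ancestors left_parent (0%nat, 1%nat) q ls -> ancestors right_parent (1%nat, ns) q rs ->
    forall n, In n (rev ls) \/ In n rs -> (n < snd q)%nat).
  { intros l r s Hl Hr n [Hn|Hn].
    - apply in_rev in Hn; exact (ancestors_lt _ _ _ _ left_parent_lt Hl n Hn).
    - exact (ancestors_lt _ _ _ _ right_parent_lt Hr n Hn). }
  assert (D = D') as E.
  { eapply ForallOrdPairs_ext_eq; [exact HO | exact HO' | |].
    - intros a b Ha Hb Hab Hba.
      apply HI in Ha; [| rewrite HD in Ha; exact (HDpos _ _ _ _ Hls Hrs Ha)].
      apply HI in Hb; [| rewrite HD in Hb; exact (HDpos _ _ _ _ Hls Hrs Hb)].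
      destruct Ha as [x Hx]; destruct Hb as [y Hy].
      specialize (Hab x y Hx Hy); specialize (Hba y x Hy Hx); lra.
    - intros n; split; intros Hn.
      + assert (Hp : (1 <= n)%nat) by (rewrite HD in Hn; exact (HDpos _ _ _ _ Hls Hrs Hn)).
        apply (HI' n Hp), (HI n Hp); assumption.
      + assert (Hp : (1 <= n)%nat) by (rewrite HD' in Hn; exact (HDpos _ _ _ _ Hls' Hrs' Hn)).
        apply (HI n Hp), (HI' n Hp); assumption. }
  rewrite HD, HD' in E.
  apply split_at_max in E; cycle 1.
  { exact (Hmax _ _ _ Hls Hrs). }
  { exact (Hmax _ _ _ Hls' Hrs'). }
  destruct E as [Ep El].
  apply (f_equal (@rev nat)) in El; rewrite !rev_involutive in El; subst ls'.
  destruct (ancestors_head _ _ _ _ Hls) as (q1 & l1 & -> & H1).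
  destruct (ancestors_head _ _ _ _ Hls') as (q1' & l1' & El & H1').
  injection El as El _.
  apply left_parent_det in H1; apply left_parent_det in H1'; rewrite <- El, <- Ep in H1'.
  assert (Hlt : forall s, (1 <= snd s)%nat -> frac_val s < 1 / INR ns ->
    (fst s < snd s)%nat).
  { intros [m p] Hp Hs; cbn [fst snd] in *.
    destruct (Nat.lt_ge_cases m p) as [|Hge]; [assumption | exfalso].
    assert (frac_val (1%nat, ns) <= frac_val (m, p)) by (apply frac_val_le; nia).
    rewrite frac_val_inv in *; lra. }
  apply Hlt in Hq; [| assumption]; apply Hlt in Hq'; [| assumption].
  rewrite <- Ep in Hq'.
  rewrite (surjective_pairing q), (surjective_pairing q'), <- Ep; f_equal.
  eapply numerator_unique; eassumption.
Qed.

Context (nstar : nat) (Hnstar : returns tau delta 1 nstar).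

Definition precedes (a b : nat) : Prop :=
  forall x y, Iset tauL tau delta a x -> Iset tauL tau delta b y -> x < y.

(* [ls] and [rs] are the denominators found so far to the left and to the right
   of the gap, nearest first. *)
Record loop_inv (lo hi : endpoint) (A : assignments) (ls rs : list nat) : Prop := {
  inv_gap : is_gap tau delta (ep_p lo) (ep_p hi) (ep_z lo) (ep_z hi);
  inv_range : 0 <= ep_z lo /\ ep_z hi <= 1;
  inv_det : (ep_m hi * ep_p lo = ep_m lo * ep_p hi + 1)%nat;
  inv_lo_lt : (ep_m lo * nstar < ep_p lo)%nat;
  inv_hi_le : (ep_m hi * nstar <= ep_p hi)%nat;
  inv_hi_ge : (ep_p hi <= ep_m hi * (nstar + 1))%nat;
  inv_lo_ge :
    (lo = Endpoint 0 1 0 /\ hi = Endpoint 1 nstar (z tau delta nstar)) \/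
    ((2 <= ep_p lo)%nat /\ (ep_p lo <= ep_m lo * (nstar + 1))%nat);
  inv_sound : forall n S, In (n, S) A ->
    (1 <= n < ep_p lo + ep_p hi)%nat /\
    (forall x, S x <-> Iset tauL tau delta n x) /\ exists x, S x;
  inv_cover : forall x, x <= 1 ->
    ep_z lo < x < ep_z hi \/ exists n S, In (n, S) A /\ S x;
  inv_lists : forall n, (exists S, In (n, S) A) <-> In n ls \/ In n rs;
  inv_left : forall n x, In n ls -> Iset tauL tau delta n x -> x <= ep_z lo;
  inv_right : forall n x, In n rs -> Iset tauL tau delta n x -> ep_z hi <= x;
  inv_ord_l : ForallOrdPairs precedes (rev ls);
  inv_ord_r : ForallOrdPairs precedes rs;
  inv_anc_l : forall q, left_parent q (ep_m lo, ep_p lo) ->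
    ancestors left_parent (0%nat, 1%nat) q ls;
  inv_anc_r : forall q, right_parent q (ep_m hi, ep_p hi) ->
    ancestors right_parent (1%nat, nstar) q rs }.

Definition complete (q : frac) (A : assignments) : Prop :=
  (forall n S, In (n, S) A ->
     (forall x, S x <-> Iset tauL tau delta n x) /\ (exists x, S x)) /\
  (forall n, (forall S, ~ In (n, S) A) -> forall x, ~ Iset tauL tau delta n x) /\
  rotation_property tauL tau delta q.

Lemma init_inv :
  exists A, init tau delta nstar
    = Running (Endpoint 0 1 0) (Endpoint 1 nstar (z tau delta nstar)) A /\
  loop_inv (Endpoint 0 1 0) (Endpoint 1 nstar (z tau delta nstar)) A
    [1%nat] [nstar].
Proof.
  eexists; split; [reflexivity |].
  pose proof (nstar_ge_2 _ _ _ Hnstar) as H2.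
  pose proof (z_nstar_bounds _ _ Hdelta Hspiral _ Hnstar) as Hz.
  pose proof (first_gap _ _ Hdelta Hspiral _ Hnstar) as Hgap.
  assert (H1 : forall x, x <= 0 <-> Iset tauL tau delta 1 x).
  { intros x; rewrite Iset_returns; unfold returns; simpl.
    split; [intros Hx; repeat split; try lia; try lra; intros; lia | tauto]. }
  assert (Hn : forall x, z tau delta nstar <= x <= 1 <-> Iset tauL tau delta nstar x).
  { intros x; rewrite Iset_returns.
    pose proof (gap_zero_r _ _ _ _ _ _ Hgap) as H0.
    pose proof (gap_lucas_r _ _ _ _ _ _ Hgap) as Ha.
    pose proof (orbit_sub tau delta (z tau delta nstar) x nstar) as E.
    split; [intros Hx | intros [Hx [_ [Hneg _]]]; split; [nra | assumption]].
    split; [lra | split; [lia | split; [nra |]]].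
    intros k Hk; apply (orbit_pos_before_nstar _ _ _ Hnstar); [lra | assumption]. }
  split; cbn [ep_m ep_p ep_z]; try lia; try lra; try assumption.
  - left; split; reflexivity.
  - intros n S [E|[E|[]]]; injection E as <- <-.
    + split; [lia | split; [assumption | exists 0; lra]].
    + split; [lia | split; [assumption | exists 1; lra]].
  - intros x Hx.
    destruct (Rle_dec x 0); [right; do 2 eexists; split; [left; reflexivity | assumption] |].
    destruct (Rlt_dec x (z tau delta nstar)); [left; lra | right].
    do 2 eexists; split; [right; left; reflexivity | simpl; lra].
  - intros n; split.
    + intros [S [E|[E|[]]]]; injection E as <- <-; simpl; auto.
    + intros [[<-|[]]|[<-|[]]]; eexists; [left | right; left]; reflexivity.
  - intros n x [<-|[]]; rewrite <- H1; auto.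
  - intros n x [<-|[]]; rewrite <- Hn; tauto.
  - constructor; [constructor | constructor].
  - constructor; [constructor | constructor].
  - intros q Hq; exact (ancestors_stop _ _ _ Hq).
  - intros q Hq; exact (ancestors_stop _ _ _ Hq).
Qed.

(** * One pass through the loop *)

Section Step.

Context (lo hi : endpoint) (A : assignments) (ls rs : list nat).
Context (Hinv : loop_inv lo hi A ls rs).

Let m := (ep_m lo + ep_m hi)%nat.
Let p := (ep_p lo + ep_p hi)%nat.

Lemma inv_p_pos : (1 <= ep_p lo)%nat /\ (1 <= ep_p hi)%nat.
Proof. split; apply (inv_gap _ _ _ _ _ Hinv). Qed.

Lemma inv_parents : are_parents (m, p) (ep_m lo, ep_p lo) (ep_m hi, ep_p hi).
Proof.
  pose proof inv_p_pos; pose proof (nstar_ge_2 _ _ _ Hnstar).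
  pose proof (inv_hi_le _ _ _ _ _ Hinv); pose proof (inv_det _ _ _ _ _ Hinv).
  apply mediant_parents; nia.
Qed.

(** A point outside the gap belongs to an assigned set whose index is below [p], so uniqueness of
    return times excludes it from [I_p]. *)
Lemma new_sound (S : R -> Prop) :
  (forall x, S x <-> (ep_z lo < x < ep_z hi) /\ orbit tau delta x p <= 0) ->
  forall x, S x <-> Iset tauL tau delta p x.
Proof.
  intros HS x; rewrite HS, Iset_returns.
  pose proof inv_p_pos; pose proof (inv_range _ _ _ _ _ Hinv).
  split.
  - intros [Hx Hneg]; split; [lra |].
    split; [unfold p; lia | split; [assumption |]].
    intros k Hk; apply (gap_pos _ _ _ _ _ _ (inv_gap _ _ _ _ _ Hinv)); assumption.
  - intros [Hx Hret]; split; [| apply Hret].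
    destruct (inv_cover _ _ _ _ _ Hinv x Hx) as [|(n & S' & HA & HS')]; [assumption |].
    destruct (inv_sound _ _ _ _ _ Hinv n S' HA) as (Hn & Heq & _).
    apply Heq, Iset_returns in HS'; destruct HS' as [_ Hret'].
    pose proof (returns_unique _ _ _ _ _ Hret Hret'); unfold p in *; lia.
Qed.

(** With the gap filled, the assigned sets cover [(-oo, 1]]; as return times are unique, no other
    [I_n] can be inhabited. *)
Lemma stop_complete (S : R -> Prop) :
  (forall x, ep_z lo < x < ep_z hi -> orbit tau delta x p <= 0) ->
  (forall x, S x <-> ep_z lo < x < ep_z hi) ->
  complete (m, p) ((p, S) :: A).
Proof.
  intros Hneg HS.
  pose proof inv_p_pos; pose proof (nstar_ge_2 _ _ _ Hnstar).
  assert (HSp : forall x, S x <-> Iset tauL tau delta p x).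
  { apply new_sound; intros x; rewrite HS; split; [auto | tauto]. }
  assert (Hex : exists x, S x).
  { exists ((ep_z lo + ep_z hi) / 2); apply HS.
    pose proof (gap_lt _ _ _ _ _ _ (inv_gap _ _ _ _ _ Hinv)); lra. }
  assert (Hsound : forall n S', In (n, S') ((p, S) :: A) ->
    (forall x, S' x <-> Iset tauL tau delta n x) /\ (exists x, S' x)).
  { intros n S' [E|HA].
    - injection E as <- <-; auto.
    - apply (inv_sound _ _ _ _ _ Hinv n S' HA). }
  assert (Hcover : forall x, x <= 1 -> exists n S', In (n, S') ((p, S) :: A) /\ S' x).
  { intros x Hx; destruct (inv_cover _ _ _ _ _ Hinv x Hx) as [Hg|(n & S' & HA & HS')].
    - exists p, S; split; [left; reflexivity | apply HS; assumption].
    - exists n, S'; split; [right |]; assumption. }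
  assert (Hmem : forall n x, Iset tauL tau delta n x -> exists S', In (n, S') ((p, S) :: A)).
  { intros n x Hx; destruct (Hcover x (proj1 Hx)) as (n' & S' & HA & HS').
    apply (Hsound n' S' HA), Iset_returns in HS'; apply Iset_returns in Hx.
    rewrite (returns_unique _ _ _ _ _ (proj2 Hx) (proj2 HS')); eauto. }
  split; [assumption | split].
  { intros n Hn x Hx; destruct (Hmem n x Hx) as [S' HA]; exact (Hn S' HA). }
  pose proof inv_parents as Hpar.
  exists nstar, (rev ls ++ p :: rs).
  split; [apply return_time_returns; assumption |].
  pose proof (inv_det _ _ _ _ _ Hinv); pose proof (inv_lo_lt _ _ _ _ _ Hinv).
  pose proof (inv_hi_le _ _ _ _ _ Hinv); pose proof (inv_hi_ge _ _ _ _ _ Hinv).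
  split; [apply mediant_irreducible; [tauto | assumption] |].
  rewrite <- !frac_val_inv.
  split.
  { apply frac_val_le; unfold m, p; try lia.
    (* For the initial gap the mediant is exactly [1/(n*+1)]; later both ends are at least that
       value. *)
    destruct (inv_lo_ge _ _ _ _ _ Hinv) as [[-> ->]|[]]; cbn [ep_m ep_p]; lia. }
  split; [apply frac_val_lt; unfold m, p; lia |].
  split.
  { exists ls, rs; split; [| split; [| reflexivity]].
    - apply (inv_anc_l _ _ _ _ _ Hinv); eexists; exact Hpar.
    - apply (inv_anc_r _ _ _ _ _ Hinv); eexists; exact Hpar. }
  split.
  { intros n _; rewrite in_app_iff, <- in_rev; simpl.
    pose proof (inv_lists _ _ _ _ _ Hinv n) as HL.
    split.
    - intros [x Hx]; destruct (Hmem n x Hx) as [S' [E|HA]].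
      + injection E as <- _; auto.
      + destruct (proj1 HL (ex_intro _ S' HA)); auto.
    - intros Hn.
      assert (exists S', In (n, S') ((p, S) :: A)) as [S' HA].
      { destruct Hn as [Hn|[<-|Hn]]; [| exists S; left; reflexivity |];
          (destruct (proj2 HL) as [S' HA]; [auto | exists S'; right; assumption]). }
      destruct (Hsound n S' HA) as [Heq [x Hx]]; exists x; apply Heq; assumption. }
  split.
  { intros x Hx; destruct (Hcover x Hx) as (n & S' & HA & HS').
    exists n; apply (Hsound n S' HA); assumption. }
  pose proof (gap_lt _ _ _ _ _ _ (inv_gap _ _ _ _ _ Hinv)).
  assert (Hl := inv_left _ _ _ _ _ Hinv); assert (Hr := inv_right _ _ _ _ _ Hinv).
  apply ForallOrdPairs_app.
  - apply (inv_ord_l _ _ _ _ _ Hinv).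
  - constructor; [| apply (inv_ord_r _ _ _ _ _ Hinv)].
    apply Forall_forall; intros n Hn x y Hx Hy.
    apply HSp, HS in Hx; specialize (Hr n y Hn Hy); lra.
  - intros a b Ha [<-|Hb] x y Hx Hy; apply in_rev in Ha; specialize (Hl a x Ha Hx).
    + apply HSp, HS in Hy; lra.
    + specialize (Hr b y Hb Hy); lra.
Qed.

Lemma go_right_inv (zp : R) (S : R -> Prop) :
  ep_z lo < zp < ep_z hi -> orbit tau delta zp p = 0 -> 0 < lucas tau delta p ->
  (forall x, S x <-> ep_z lo < x <= zp) ->
  loop_inv (Endpoint m p zp) hi ((p, S) :: A) (p :: ls) rs.
Proof.
  intros Hz H0 Ha HS.
  pose proof inv_p_pos; pose proof (nstar_ge_2 _ _ _ Hnstar).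
  pose proof (inv_gap _ _ _ _ _ Hinv) as Hgap.
  pose proof (inv_range _ _ _ _ _ Hinv).
  pose proof (inv_det _ _ _ _ _ Hinv); pose proof (inv_lo_lt _ _ _ _ _ Hinv).
  pose proof (inv_hi_le _ _ _ _ _ Hinv); pose proof (inv_hi_ge _ _ _ _ _ Hinv).
  assert (HSp : forall x, S x <-> Iset tauL tau delta p x).
  { apply new_sound; intros x; rewrite HS.
    pose proof (orbit_sub tau delta x zp p).
    split; intros; repeat split; try lra; nra. }
  split; cbn [ep_m ep_p ep_z]; try apply Hinv.
  - apply (gap_split_r _ _ Hdelta Hspiral _ _ _ _ Hgap); assumption.
  - lra.
  - unfold m, p; lia.
  - unfold m, p; lia.
  - right; unfold m, p; split; [lia |].
    destruct (inv_lo_ge _ _ _ _ _ Hinv) as [[-> ->]|[]]; cbn [ep_m ep_p]; lia.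
  - intros n S' [E|HA].
    + injection E as <- <-; split; [unfold p; lia | split; [assumption |]].
      exists zp; apply HS; lra.
    + destruct (inv_sound _ _ _ _ _ Hinv n S' HA) as [Hn ?]; split; [unfold p; lia | assumption].
  - intros x Hx; destruct (inv_cover _ _ _ _ _ Hinv x Hx) as [Hg|(n & S' & HA & HS')].
    + destruct (Rle_dec x zp).
      * right; exists p, S; split; [left; reflexivity | apply HS; lra].
      * left; lra.
    + right; exists n, S'; split; [right |]; assumption.
  - intros n; pose proof (inv_lists _ _ _ _ _ Hinv n) as HL; simpl; split.
    + intros [S' [E|HA]]; [injection E as <- _; auto |].
      destruct (proj1 HL (ex_intro _ S' HA)); auto.
    + intros [[<-|Hn]|Hn]; [exists S; left; reflexivity | |];
        (destruct (proj2 HL) as [S' HA]; [auto | exists S'; right; assumption]).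
  - intros n x [<-|Hn] Hx.
    + apply HSp, HS in Hx; lra.
    + pose proof (inv_left _ _ _ _ _ Hinv n x Hn Hx); lra.
  - simpl; apply ForallOrdPairs_app; [apply Hinv | repeat constructor |].
    intros a b Hal [<-|[]] x y Hx Hy; apply in_rev in Hal.
    pose proof (inv_left _ _ _ _ _ Hinv a x Hal Hx); apply HSp, HS in Hy; lra.
  (* The old left end is the left parent of the mediant, so the former chain continues from
     [(m, p)]; [p >= 2] keeps the mediant distinct from [0/1]. *)
  - intros q Hq; apply (ancestors_next _ _ q (m, p)); [assumption | |].
    + intros E; injection E; unfold p; lia.
    + apply (inv_anc_l _ _ _ _ _ Hinv); eexists; exact inv_parents.
Qed.

(** In the initial gap the value at [0] at time [nstar + 1] is that of [1] at time [nstar], hence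
    nonpositive, whereas a decreasing function with a zero to the right of [0] is positive there. *)
Lemma first_step_not_left (zp : R) :
  ep_z lo < zp < ep_z hi -> orbit tau delta zp p = 0 -> lucas tau delta p < 0 ->
  (2 <= ep_p lo)%nat.
Proof.
  intros Hz H0 Ha.
  destruct (inv_lo_ge _ _ _ _ _ Hinv) as [[El Eh]|[]]; [exfalso | assumption].
  unfold p in *; rewrite El, Eh in *; cbn [ep_p ep_z] in *.
  pose proof (orbit_0_succ tau delta nstar) as E.
  pose proof (orbit_sub tau delta 0 zp (1 + nstar)) as E'.
  destruct Hnstar as [_ [Hneg _]]; simpl Nat.add in *; nra.
Qed.

Lemma go_left_inv (zp : R) (S : R -> Prop) :
  ep_z lo < zp < ep_z hi -> orbit tau delta zp p = 0 -> lucas tau delta p < 0 ->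
  (forall x, S x <-> zp <= x < ep_z hi) ->
  loop_inv lo (Endpoint m p zp) ((p, S) :: A) ls (p :: rs).
Proof.
  intros Hz H0 Ha HS.
  pose proof (first_step_not_left zp Hz H0 Ha) as Hlo.
  pose proof inv_p_pos; pose proof (nstar_ge_2 _ _ _ Hnstar).
  pose proof (inv_gap _ _ _ _ _ Hinv) as Hgap.
  pose proof (inv_range _ _ _ _ _ Hinv).
  pose proof (inv_det _ _ _ _ _ Hinv); pose proof (inv_lo_lt _ _ _ _ _ Hinv).
  pose proof (inv_hi_le _ _ _ _ _ Hinv); pose proof (inv_hi_ge _ _ _ _ _ Hinv).
  assert (Hge : (ep_p lo <= ep_m lo * (nstar + 1))%nat).
  { destruct (inv_lo_ge _ _ _ _ _ Hinv) as [[El _]|[]]; [| assumption].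
    rewrite El in Hlo; cbn [ep_p] in Hlo; lia. }
  assert (HSp : forall x, S x <-> Iset tauL tau delta p x).
  { apply new_sound; intros x; rewrite HS.
    pose proof (orbit_sub tau delta x zp p).
    split; intros; repeat split; try lra; nra. }
  split; cbn [ep_m ep_p ep_z]; try apply Hinv.
  - apply (gap_split_l _ _ Hdelta Hspiral _ _ _ _ Hgap); assumption.
  - lra.
  - unfold m, p; lia.
  - unfold m, p; lia.
  - unfold m, p; lia.
  - right; split; assumption.
  - intros n S' [E|HA].
    + injection E as <- <-; split; [unfold p; lia | split; [assumption |]].
      exists zp; apply HS; lra.
    + destruct (inv_sound _ _ _ _ _ Hinv n S' HA) as [Hn ?]; split; [unfold p; lia | assumption].
  - intros x Hx; destruct (inv_cover _ _ _ _ _ Hinv x Hx) as [Hg|(n & S' & HA & HS')].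
    + destruct (Rlt_dec x zp).
      * left; lra.
      * right; exists p, S; split; [left; reflexivity | apply HS; lra].
    + right; exists n, S'; split; [right |]; assumption.
  - intros n; pose proof (inv_lists _ _ _ _ _ Hinv n) as HL; simpl; split.
    + intros [S' [E|HA]]; [injection E as <- _; auto |].
      destruct (proj1 HL (ex_intro _ S' HA)); auto.
    + intros [Hn|[<-|Hn]]; [| exists S; left; reflexivity |];
        (destruct (proj2 HL) as [S' HA]; [auto | exists S'; right; assumption]).
  - intros n x [<-|Hn] Hx.
    + apply HSp, HS in Hx; lra.
    + pose proof (inv_right _ _ _ _ _ Hinv n x Hn Hx); lra.
  - constructor; [apply Forall_forall | apply Hinv].
    intros b Hb x y Hx Hy.
    pose proof (inv_right _ _ _ _ _ Hinv b y Hb Hy); apply HSp, HS in Hx; lra.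
  - intros q Hq; apply (ancestors_next _ _ q (m, p)); [assumption | |].
    (* The mediant is strictly below [1/n*], so the chain has not reached its stopping fraction. *)
    + intros E; injection E; unfold p.
      pose proof (gap_pl _ _ _ _ _ _ Hgap); nia.
    + apply (inv_anc_r _ _ _ _ _ Hinv); eexists; exact inv_parents.
Qed.

Lemma step_progress :
  (exists A', step tau delta (Running lo hi A) = Stopped (m, p) A' /\ complete (m, p) A') \/
  (exists lo' hi' A' ls' rs',
     step tau delta (Running lo hi A) = Running lo' hi' A' /\
     loop_inv lo' hi' A' ls' rs' /\ (p < ep_p lo' + ep_p hi')%nat).
Proof.
  pose proof inv_p_pos as Hp; pose proof (inv_gap _ _ _ _ _ Hinv) as Hgap.
  pose proof (alpha_lucas _ _ Hdelta Hspiral (p - 1)) as Ea.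
  replace (S (p - 1)) with p in Ea by (unfold p; lia).
  unfold step; cbv zeta; fold m p; rewrite Ea.
  destruct (Req_EM_T (lucas tau delta p) 0) as [E0|E0].
  { left; eexists; split; [reflexivity |].
    apply stop_complete; [| reflexivity].
    intros x Hx; eapply gap_stop; eauto. }
  destruct (between_dec (ep_z lo) (ep_z hi) (z tau delta p)) as [Hz|Hz].
  2: { left; eexists; split; [reflexivity |].
       apply stop_complete; [| reflexivity].
       intros x Hx; eapply gap_stop; eauto. }
  pose proof (orbit_z _ _ Hdelta Hspiral p ltac:(unfold p; lia) E0) as Hz0.
  right; destruct (Rlt_dec (lucas tau delta p) 0) as [Hneg|Hneg].
  - do 5 eexists; split; [reflexivity | split].
    + apply go_left_inv; [assumption .. | reflexivity].
    + cbn [ep_p]; unfold p; lia.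
  - do 5 eexists; split; [reflexivity | split].
    + apply go_right_inv; [assumption | assumption | lra | reflexivity].
    + cbn [ep_p]; unfold p; lia.
Qed.

End Step.

(** * Termination through bounded denominators *)

Lemma inv_bounded :
  exists M, forall lo hi A ls rs, loop_inv lo hi A ls rs -> (ep_p lo + ep_p hi <= M)%nat.
Proof.
  destruct (Pow_x_infinity delta ltac:(rewrite Rabs_right; lra)
    ((energy tau delta 0 + energy tau delta 1 + 1) / (delta - tau ^ 2 / 4))) as [K HK].
  specialize (HK K (Nat.le_refl K)).
  rewrite Rabs_right in HK by (apply Rle_ge, pow_le; lra).
  assert (HK' : energy tau delta 0 + energy tau delta 1 < delta ^ K * (delta - tau ^ 2 / 4)).
  { apply Rge_le, (Rmult_le_compat_r (delta - tau ^ 2 / 4)) in HK; [| lra].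
    unfold Rdiv at 1 in HK; rewrite Rmult_assoc, Rinv_l in HK; lra. }
  (* The second summand covers the initial gap, whose left denominator [1] is out of reach of
     [gap_bounded]. *)
  exists (2 * K + (1 + nstar))%nat; intros lo hi A ls rs Hinv.
  destruct (inv_lo_ge _ _ _ _ _ Hinv) as [[-> ->]|[Hlo _]]; [cbn [ep_p]; lia |].
  destruct (inv_range _ _ _ _ _ Hinv) as [H0 H1].
  pose proof (gap_bounded tau delta Hdelta Hspiral _ _ _ _ (inv_gap _ _ _ _ _ Hinv)
                K Hlo H0 H1 HK').
  lia.
Qed.

Lemma loop_terminates lo hi A ls rs :
  loop_inv lo hi A ls rs ->
  exists k q A', Nat.iter k (step tau delta) (Running lo hi A) = Stopped q A' /\ complete q A'.
Proof.
  destruct inv_bounded as [M HM].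
  (* The distance of the denominator sum to its bound strictly decreases at each pass. *)
  remember (M - (ep_p lo + ep_p hi))%nat as fuel eqn:E.
  revert lo hi A ls rs E; induction fuel as [fuel IH] using lt_wf_ind.
  intros lo hi A ls rs E Hinv.
  destruct (step_progress _ _ _ _ _ Hinv)
    as [(A' & Hstep & HC)|(lo' & hi' & A' & ls' & rs' & Hstep & Hinv' & Hlt)].
  - exists 1%nat; do 2 eexists; split; [exact Hstep | exact HC].
  - pose proof (HM _ _ _ _ _ Hinv).
    pose proof (HM _ _ _ _ _ Hinv').
    destruct (IH (M - (ep_p lo' + ep_p hi'))%nat ltac:(lia) lo' hi' A' ls' rs' eq_refl Hinv')
      as (k & q & A'' & Hk & HC).
    exists (S k), q, A''; split; [| assumption].
    rewrite Nat.iter_succ_r, Hstep; exact Hk.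
Qed.

End Algorithm.

Theorem theorem2p6 (tauL tauR deltaR : R)
    (hdelta : deltaR > 1) (hdelta_tau : deltaR > tauR ^ 2 / 4) :
  exists nstar : nat,
    is_return_time tauL tauR deltaR 1 nstar /\
    alpha tauR deltaR (nstar - 1) <> 0 /\
    0 < z tauR deltaR nstar <= 1 /\
    exists (k : nat) (q : frac) (A : assignments),
      Nat.iter k (step tauR deltaR) (init tauR deltaR nstar) = Stopped q A /\
      (forall (n : nat) (S : R -> Prop), In (n, S) A ->
         (forall x : R, S x <-> Iset tauL tauR deltaR n x) /\
         (exists x : R, S x)) /\
      (forall n : nat, (1 <= n)%nat -> (forall S : R -> Prop, ~ In (n, S) A) ->
         forall x : R, ~ Iset tauL tauR deltaR n x) /\
      is_rotation_number tauL tauR deltaR q.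
Proof.
  destruct (orbit_1_nonpos tauR deltaR hdelta hdelta_tau) as [k1 [Hk1 Hneg]].
  destruct (returns_exists tauR deltaR 1 k1 Hk1 Hneg) as [nstar Hn].
  exists nstar.
  split; [apply return_time_returns; assumption |].
  split.
  { rewrite alpha_lucas by assumption.
    pose proof (nstar_ge_2 _ _ _ Hn).
    replace (S (nstar - 1)) with nstar by lia.
    apply Rlt_not_eq, (lucas_nstar_neg _ _ _ Hn). }
  split; [apply z_nstar_bounds; assumption |].
  destruct (init_inv tauL tauR deltaR hdelta hdelta_tau nstar Hn) as (A0 & -> & Hinv).
  destruct (loop_terminates tauL tauR deltaR hdelta hdelta_tau nstar Hn _ _ _ _ _ Hinv)
    as (k & q & A & Hk & Hsound & Hempty & Hrot).
  exists k, q, A; split; [assumption |].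
  split; [assumption |].
  split; [auto |].
  split; [assumption |].
  intros q'; apply rotation_property_unique; assumption.
Qed.
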